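(* Let $\mathcal{R}$ be a $2$-torsion free commutative ring with unity and let $X$ be a locally finite pre-ordered set consisting of a finite number of connected components. Then every Lie triple derivation $L$ of the incidence algebra $I(X,\mathcal{R})$ is proper; that is, there exist a derivation $D$ of $I(X,\mathcal{R})$ and an $\mathcal{R}$-linear map $F: I(X,\mathcal{R})\to I(X,\mathcal{R})$ with image contained in the centre of $I(X,\mathcal{R})$ such that $L=D+F$.
   Context: A pre-ordered set $(X,\leqslant)$ is a set with a reflexive and transitive relation; it is locally finite if for all $x\leqslant y$ there are only finitely many $z\in X$ with $x\leqslant z\leqslant y$. The connected components of $X$ are the equivalence classes of the relation under which two elements are equivalent if they can be joined by a finite sequence of elements of $X$ in which consecutive elements are comparable (i.e. $u\leqslant v$ or $v\leqslant u$). The incidence algebra is $I(X,\mathcal{R})=\{f:X\times X\to\mathcal{R}\mid f(x,y)=0 \text{ if } x\not\leqslant y\}$, with pointwise addition and scalar multiplication and product $(fg)(x,y)=\sum_{x\leqslant z\leqslant y}f(x,z)g(z,y)$ for $x\leqslant y$. $\mathcal{R}$ is $2$-torsion free if $2r=0$ implies $r=0$ for $r\in\mathcal{R}$. For an associative $\mathcal{R}$-algebra $A$, write $[x,y]=xy-yx$. A derivation of $A$ is an $\mathcal{R}$-linear map $D:A\to A$ with $D(xy)=D(x)y+xD(y)$. A Lie triple derivation of $A$ is an $\mathcal{R}$-linear map $L:A\to A$ with $L([[x,y],z])=[[L(x),y],z]+[[x,L(y)],z]+[[x,y],L(z)]$ for all $x,y,z\in A$. *)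

(* Defs.v *)
From HB Require Import structures.
From mathcomp Require Import all_boot all_order all_algebra.
From mathcomp Require Import finmap.
From mathcomp Require Import boolp classical_sets functions cardinality fsbigop.

Set Implicit Arguments.
Unset Strict Implicit.
Unset Printing Implicit Defensive.

Import Order.TTheory GRing.Theory.
Local Open Scope classical_set_scope.
Local Open Scope ring_scope.

HB.mixin Record Preorder_isLocallyFinite (d : Order.disp_t) X
    of Order.Preorder d X := {
  finite_interval : forall x y : X,
    (x <= y)%O -> finite_set [set z : X | (x <= z <= y)%O]
}.

#[short(type="locallyFinitePreorderType")]
HB.structure Definition LocallyFinitePreorder (d : Order.disp_t) :=
  { X of Order.Preorder d X & Preorder_isLocallyFinite d X }.

Section Components.
Context {d : Order.disp_t} {X : preorderType d}.

Definition component (x : X) : set X :=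
  [set y | exists2 s : seq X, path >=<%O x s & last x s = y].

Definition components : set (set X) := range component.

End Components.
Arguments components {d} X.

Section IncidenceAlgebra.
Context {d : Order.disp_t} (X : locallyFinitePreorderType d)
  (R : comPzRingType).

(* R^o is R seen as a module over itself, so that X -> X -> R^o is an
   R-module under the pointwise operations. *)
Definition is_incidence : {pred X -> X -> R^o} :=
  fun f => `[< forall x y : X, ~~ (x <= y)%O -> f x y = 0 >].

Record incidence := Incidence {
  incidence_fun :> X -> X -> R^o;
  _ : is_incidence incidence_fun
}.

HB.instance Definition _ := [isSub for incidence_fun].
HB.instance Definition _ := [Choice of incidence by <:].

Lemma incidence_submod_closed : submod_closed is_incidence.
Proof.
split=> [|a f g /asboolP f0 /asboolP g0]; apply/asboolP => x y xy //.
by change (a * f x y + g x y = 0); rewrite f0 // g0 // mulr0 addr0.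
Qed.

HB.instance Definition _ :=
  GRing.SubChoice_isSubLmodule.Build R (X -> X -> R^o) is_incidence incidence
    incidence_submod_closed.

Implicit Types f g h : incidence.

Lemma incidence0 f (x y : X) : ~~ (x <= y)%O -> f x y = 0.
Proof. by case: f => f /= /asboolP; apply. Qed.

Lemma incidenceP f g : (forall x y, f x y = g x y) -> f = g.
Proof. by move=> fg; apply: val_inj; apply/funext => x; apply/funext. Qed.

Lemma incidenceDE f g x y : (f + g) x y = f x y + g x y.
Proof. by []. Qed.

Lemma incidenceNE f x y : (- f) x y = - f x y.
Proof. by []. Qed.

Lemma incidenceZE (a : R) f x y : (a *: f) x y = a * f x y.
Proof. by []. Qed.

Let interval (x y : X) := [set z : X | (x <= z <= y)%O].

Let finite_interval_all x y : finite_set (interval x y).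
Proof.
have [xy|xy] := boolP (x <= y)%O; first exact: finite_interval.
rewrite (_ : interval x y = set0) //.
by apply/seteqP; split=> // z /= /andP[xz /(le_trans xz)]; rewrite (negPf xy).
Qed.

(* \sum_(z \in A) adds over the support in A, and is 0 if that is infinite; this
   cannot happen here because intervals are finite. *)
Let mul_fun f g (x y : X) : R^o :=
  \sum_(z \in [set z : X | (x <= z <= y)%O]) (f x z * g z y).

Let mul_subproof f g : is_incidence (mul_fun f g).
Proof.
apply/asboolP => x y xy; rewrite /mul_fun fsbig1 // => z /= /andP[xz].
by move=> /(le_trans xz); rewrite (negPf xy).
Qed.

Definition incidence_mul f g : incidence := Incidence (mul_subproof f g).

Let one_subproof : is_incidence (fun x y => (x == y)%:R).
Proof. by apply/asboolP => x y; have [->|//] := eqVneq x y; rewrite lexx. Qed.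

Definition incidence_one : incidence := Incidence one_subproof.

Let mul_widen f g x y (A : set X) : finite_set A -> interval x y `<=` A ->
  incidence_mul f g x y = \sum_(z <- fset_set A) f x z * g z y.
Proof.
move=> finA xyA; rewrite -fsbig_finite //=; apply: fsbig_widen => //.
move=> z [_ /= /negP]; rewrite negb_and => /orP[xz|zy].
  by rewrite incidence0 // mul0r.
by rewrite [g _ _]incidence0 // mulr0.
Qed.

Let mulA : associative incidence_mul.
Proof.
move=> f g h; apply: incidenceP => x y; set A := interval x y.
have finA : finite_set A by exact: finite_interval_all.
have mem z : z \in fset_set A -> (x <= z <= y)%O.
  by rewrite in_fset_set // inE.
rewrite !(mul_widen _ _ finA) //.
rewrite (@eq_big_seq _ _ _ _ _ _
  (fun z => \sum_(w <- fset_set A) f x z * (g z w * h w y))); last first.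
  move=> z /mem /andP[xz zy]; rewrite (mul_widen _ _ finA) ?mulr_sumr //.
  by move=> w /= /andP[zw wy]; rewrite /A /interval /= wy (le_trans xz).
rewrite exchange_big; apply: eq_big_seq => w /mem /andP[xw wy].
rewrite (mul_widen _ _ finA) ?mulr_suml; last first.
  by move=> z /= /andP[xz zw]; rewrite /A /interval /= xz (le_trans zw).
by apply: eq_bigr => z _; rewrite mulrA.
Qed.

Let mul1 : left_id incidence_one incidence_mul.
Proof.
move=> f; apply: incidenceP => x y.
have [xy|xy] := boolP (x <= y)%O; last by rewrite !incidence0.
rewrite /= /mul_fun -(@fsbig_widen _ _ _ _ [set x]) /=.
- by rewrite fsbig_set1 eqxx mul1r.
- by move=> _ ->; rewrite /= lexx.
- by move=> z [_ /eqP]; rewrite eq_sym => /negPf /= ->; rewrite mul0r.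
Qed.

Let mulf1 : right_id incidence_one incidence_mul.
Proof.
move=> f; apply: incidenceP => x y.
have [xy|xy] := boolP (x <= y)%O; last by rewrite !incidence0.
rewrite /= /mul_fun -(@fsbig_widen _ _ _ _ [set y]) /=.
- by rewrite fsbig_set1 eqxx mulr1.
- by move=> _ ->; rewrite /= lexx xy.
- by move=> z [_ /eqP] /negPf /= ->; rewrite mulr0.
Qed.

Let mulDl : left_distributive incidence_mul +%R.
Proof.
move=> f g h; apply: incidenceP => x y; rewrite incidenceDE.
have finA := finite_interval_all x y.
rewrite !(mul_widen _ _ finA) // -big_split.
by apply: eq_bigr => z _; exact: mulrDl.
Qed.

Let mulDr : right_distributive incidence_mul +%R.
Proof.
move=> f g h; apply: incidenceP => x y; rewrite incidenceDE.
have finA := finite_interval_all x y.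
rewrite !(mul_widen _ _ finA) // -big_split.
by apply: eq_bigr => z _; exact: mulrDr.
Qed.

HB.instance Definition _ := GRing.Zmodule_isPzRing.Build incidence
  mulA mul1 mulf1 mulDl mulDr.

Lemma incidenceME f g x y :
  (f * g) x y = \sum_(z \in [set z : X | (x <= z <= y)%O]) (f x z * g z y).
Proof. by []. Qed.

Lemma incidence1E x y : (1 : incidence) x y = (x == y)%:R.
Proof. by []. Qed.

(* The library's algType R excludes the trivial ring, which occurs here when X
   is empty or R is trivial; hence the algebra axioms are stated separately. *)
Lemma incidence_scalerAl (a : R) f g : a *: (f * g) = (a *: f) * g.
Proof.
apply: incidenceP => x y; rewrite incidenceZE.
have finA := finite_interval_all x y.
rewrite !(mul_widen _ _ finA) // mulr_sumr.
by apply: eq_bigr => z _; rewrite incidenceZE mulrA.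
Qed.

Lemma incidence_scalerAr (a : R) f g : a *: (f * g) = f * (a *: g).
Proof.
apply: incidenceP => x y; rewrite incidenceZE.
have finA := finite_interval_all x y.
rewrite !(mul_widen _ _ finA) // mulr_sumr.
by apply: eq_bigr => z _; rewrite incidenceZE mulrCA.
Qed.

End IncidenceAlgebra.
Arguments incidence_mul {d X R} f g : simpl never.

Definition torsion_free2 (R : comPzRingType) := forall r : R, 2 * r = 0 -> r = 0.

(* For an R-algebra A, the R-linearity of the maps below is carried by the type
   {linear A -> A} of the maps to which these predicates are applied. *)
Section Derivations.
Context {A : pzRingType}.

Definition lie (x y : A) : A := x * y - y * x.

Definition derivation (D : A -> A) :=
  forall x y : A, D (x * y) = D x * y + x * D y.

Definition lie_triple_derivation (L : A -> A) := forall x y z : A,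
  L (lie (lie x y) z) =
  lie (lie (L x) y) z + lie (lie x (L y)) z + lie (lie x y) (L z).

Definition central (x : A) := forall y : A, x * y = y * x.

End Derivations.

(* Main.v *)
(* Subtract from L the inner derivation [b, -] with b(y, x) = L(e_x)(y, x); the
   remaining M maps every idempotent e_x to a diagonal function.  Applying M to
   [[e_x, f], e_y] gives M(f)(x, y) = c(x, y) f(x, y) for x <> y, with
   c(x, y) = M(e_xy)(x, y), and applying it to [[e_xy, f], e_y] shows that the
   diagonal of M(f) is constant along comparable elements: the case f = e_y
   and 2-torsion freeness remove the error term.  Finally c is an additive cocycle, so
   f |-> c(x, y) f(x, y) is a derivation, and what is left of M is diagonal and
   constant on connected components, hence central.  Only single entries of M(f)
   are ever computed, so f may have infinite support. *)
Require Import Defs.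
From HB Require Import structures.
From mathcomp Require Import all_boot all_order all_algebra.
From mathcomp Require Import boolp classical_sets functions cardinality fsbigop.
From mathcomp Require Import ring.

Set Implicit Arguments.
Unset Strict Implicit.
Unset Printing Implicit Defensive.

Import Order.TTheory GRing.Theory.
Local Open Scope classical_set_scope.
Local Open Scope ring_scope.

(** * Brackets and derivations in an arbitrary ring *)

Section LieTheory.
Context {A : pzRingType}.
Implicit Types (x y z : A) (D : {additive A -> A}).

Lemma lie0l x : lie 0 x = 0.
Proof. by rewrite /lie mul0r mulr0 subr0. Qed.

Lemma lieDl x y z : lie (x + y) z = lie x z + lie y z.
Proof. by rewrite /lie mulrDl mulrDr opprD addrACA. Qed.

Lemma lieBl x y z : lie (x - y) z = lie x z - lie y z.
Proof. by rewrite /lie mulrBl mulrBr !opprD addrACA. Qed.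

Lemma lieBr x y z : lie x (y - z) = lie x y - lie x z.
Proof. by rewrite /lie mulrBl mulrBr !opprD addrACA. Qed.

Lemma derivation_lie D : derivation D ->
  forall x y, D (lie x y) = lie (D x) y + lie x (D y).
Proof.
by move=> DM x y; rewrite /lie raddfB !DM opprD [- _ - _ in LHS]addrC addrACA.
Qed.

Lemma derivation_lie_triple D : derivation D -> lie_triple_derivation D.
Proof.
by move=> DM x y z; rewrite !derivation_lie // lieDl.
Qed.

Lemma lie_derivation x : derivation (lie x).
Proof.
by move=> y z; rewrite /lie mulrBl mulrBr !mulrA addrA subrK.
Qed.

Lemma derivationD D D' : derivation D -> derivation D' -> derivation (D \+ D').
Proof.
by move=> dD dD' x y /=; rewrite dD dD' mulrDl mulrDr addrACA.
Qed.

Lemma lie_tripleB D D' : lie_triple_derivation D -> lie_triple_derivation D' ->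
  lie_triple_derivation (D \- D').
Proof.
move=> LD LD' x y z /=; rewrite LD LD' (lieBl (D x)) (lieBr x).
rewrite (lieBl (lie (D x) y)) (lieBl (lie x (D y))) (lieBr _ (D z)) !opprD.
by rewrite [LHS]addrACA; congr (_ + _); rewrite addrACA.
Qed.

End LieTheory.

(** * Entries of products, matrix units and the centre *)

Section Incidence.
Context {d : Order.disp_t} {X : locallyFinitePreorderType d} {R : comPzRingType}.
Implicit Types (f g h : incidence X R) (u v w x y z : X) (a : R).

(* Entries are given the type R rather than R^o, so that the arithmetic on them
   is elaborated in the ring R itself. *)
Definition entry f x y : R := f x y.

Lemma eq_entry f g : (forall x y, entry f x y = entry g x y) -> f = g.
Proof. exact: incidenceP. Qed.

Lemma entry_out f x y : ~~ (x <= y)%O -> entry f x y = 0.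
Proof. exact: incidence0. Qed.

Lemma entry0 x y : entry 0 x y = 0.
Proof. by []. Qed.

Lemma entryD f g x y : entry (f + g) x y = entry f x y + entry g x y.
Proof. by []. Qed.

Lemma entryB f g x y : entry (f - g) x y = entry f x y - entry g x y.
Proof. by []. Qed.

Lemma entryZ a f x y : entry (a *: f) x y = a * entry f x y.
Proof. by []. Qed.

Lemma entryM f g x y : entry (f * g) x y =
  \sum_(z \in [set z : X | (x <= z <= y)%O]) (entry f x z * entry g z y).
Proof. exact: incidenceME. Qed.

Lemma entryM_single f g u v w :
  (forall z, z != w -> entry f u z * entry g z v = 0) ->
  entry (f * g) u v = entry f u w * entry g w v.
Proof.
move=> fg0; rewrite entryM.
have [uwv|] := boolP (u <= w <= v)%O; last first.
  (* For [w] outside the interval the sum has no [w] term, but then one of the two factors is an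
     entry outside the order. *)
  rewrite negb_and => nuwv; have fgw0 : entry f u w * entry g w v = 0.
    case/orP: nuwv => [uw|wv]; first by rewrite entry_out // mul0r.
    by rewrite [entry g _ _]entry_out // mulr0.
  by rewrite fgw0 fsbig1 // => z _; have [->|/fg0] := eqVneq z w.
rewrite -(@fsbig_widen _ _ _ _ [set w]) /=; first by rewrite fsbig_set1.
  by move=> _ ->.
by move=> z [_ /eqP]; exact: fg0.
Qed.

(* The matrix units, and the bracket below, are introduced through opaque
   existence proofs: unification would otherwise unfold them down to the
   summation over intervals. *)
Lemma matrix_units_exist : {e : X -> X -> incidence X R |
  forall x y u v, (x <= y)%O -> entry (e x y) u v = (u == x)%:R * (v == y)%:R}.
Proof.
pose e x y u v : R^o := ((x <= y)%O && (u == x) && (v == y))%:R.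
have eP x y : e x y \in @is_incidence d X R.
  apply/asboolP => u v uv; rewrite /e.
  by case: eqP => [<-|]; case: eqP => [<-|]; rewrite ?(negPf uv) ?andbF.
exists (fun x y => Incidence (eP x y)) => x y u v xy.
by rewrite /entry /= /e xy -natrM mulnb.
Qed.

Definition E := sval matrix_units_exist.

Lemma entryE x y u v : (x <= y)%O ->
  entry (E x y) u v = (u == x)%:R * (v == y)%:R.
Proof. by move=> xy; rewrite (svalP matrix_units_exist). Qed.

Lemma entryEM x y f u v : (x <= y)%O ->
  entry (E x y * f) u v = (u == x)%:R * entry f y v.
Proof.
move=> xy; rewrite (@entryM_single _ _ _ _ y) ?entryE ?eqxx ?mulr1 //.
by move=> z /negPf zy; rewrite entryE // zy mulr0 mul0r.
Qed.

Lemma entryME x y f u v : (x <= y)%O ->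
  entry (f * E x y) u v = entry f u x * (v == y)%:R.
Proof.
move=> xy; rewrite (@entryM_single _ _ _ _ x) ?entryE ?eqxx ?mul1r //.
by move=> z /negPf zy; rewrite entryE // zy mul0r mulr0.
Qed.

Definition diagonal f := forall x y, x != y -> entry f x y = 0.

Lemma entryM_diagl h f u v : diagonal h ->
  entry (h * f) u v = entry h u u * entry f u v.
Proof.
move=> dh; apply: entryM_single => z zu.
by rewrite dh ?mul0r // eq_sym.
Qed.

Lemma entryM_diagr h f u v : diagonal h ->
  entry (f * h) u v = entry f u v * entry h v v.
Proof. by move=> dh; apply: entryM_single => z zu; rewrite dh ?mulr0. Qed.

(** Right multiplication by [E y y] keeps the entry at [(x, y)], while left multiplication kills
    it. *)
Lemma central_diagonal f : central f -> diagonal f.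
Proof.
move=> cf x y xy; have : entry (f * E y y) x y = entry (E y y * f) x y.
  by rewrite cf.
by rewrite entryME // entryEM // eqxx (negPf xy) mulr1 mul0r.
Qed.

Lemma diagonal_central f : diagonal f ->
  (forall x y, (x <= y)%O -> x != y -> entry f x x = entry f y y) -> central f.
Proof.
move=> df fc g; apply: eq_entry => x y.
rewrite (entryM_diagl _ _ _ df) (entryM_diagr _ _ _ df) mulrC.
have [xy|xy] := boolP (x <= y)%O; last by rewrite entry_out // !mul0r.
by have [->//|/(fc _ _ xy) ->] := eqVneq x y.
Qed.

(** * Inner derivations and entrywise multipliers as linear maps *)

Section Inner.
Context (f : incidence X R).

Lemma lie_is_linear : linear (lie f).
Proof.
move=> a g h; rewrite /lie mulrDr mulrDl -incidence_scalerAr -incidence_scalerAl.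
by rewrite opprD addrACA scalerBr.
Qed.

HB.instance Definition _ :=
  GRing.isLinear.Build R (incidence X R) (incidence X R) _ (lie f) lie_is_linear.
End Inner.

Section Schur.
Context (c : X -> X -> R).

Lemma schur_subproof f :
  (fun x y => c x y * entry f x y : R^o) \in @is_incidence d X R.
Proof. by apply/asboolP => x y xy; rewrite entry_out // mulr0. Qed.

Definition schur f := Incidence (schur_subproof f).

Lemma entry_schur f x y : entry (schur f) x y = c x y * entry f x y.
Proof. by []. Qed.

Lemma schur_is_linear : linear schur.
Proof.
move=> a f g; apply: eq_entry => x y.
by rewrite entryD entryZ !entry_schur entryD entryZ mulrDr mulrCA.
Qed.

HB.instance Definition _ := GRing.isLinear.Build R (incidence X R)
  (incidence X R) _ schur schur_is_linear.

(** Additivity of [c] splits the multiplier over each term of the product, which is the Leibniz rule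
    termwise. *)
Lemma schur_derivation :
  (forall x y z, (x <= y)%O -> (y <= z)%O -> c x z = c x y + c y z) ->
  derivation schur.
Proof.
move=> cD f g; apply: eq_entry => x y; rewrite entryD entry_schur !entryM.
have finI : finite_set [set z : X | (x <= z <= y)%O].
  have [xy|xy] := boolP (x <= y)%O; first exact: finite_interval.
  rewrite (_ : mkset _ = set0) //; apply/seteqP; split=> // z /= /andP[xz].
  by move=> /(le_trans xz); rewrite (negPf xy).
rewrite !fsbig_finite // mulr_sumr -big_split /=; apply: eq_big_seq => z.
rewrite in_fset_set // inE /= => /andP[xz zy].
by rewrite (cD _ _ _ xz zy); ring.
Qed.

End Schur.

(** * Entries of brackets with matrix units and diagonal elements *)

Lemma bracket_exists : {b : incidence X R -> incidence X R -> incidence X R |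
  forall f g, b f g = lie f g}.
Proof. by exists lie. Qed.

Definition bracket := sval bracket_exists.

Lemma bracket_lie f g : bracket f g = lie f g.
Proof. exact: (svalP bracket_exists). Qed.

Lemma entry_bracket f g x y :
  entry (bracket f g) x y = entry (f * g) x y - entry (g * f) x y.
Proof. by rewrite bracket_lie /lie entryB. Qed.

Lemma bracket0l f : bracket 0 f = 0.
Proof. by rewrite bracket_lie lie0l. Qed.

Lemma bracketZl a f g : bracket (a *: f) g = a *: bracket f g.
Proof.
by rewrite !bracket_lie /lie -incidence_scalerAl -incidence_scalerAr -scalerBr.
Qed.

Lemma bracketZr a f g : bracket f (a *: g) = a *: bracket f g.
Proof. by rewrite !bracket_lie linearZ. Qed.

Lemma entry_bracketr x y f u v : (x <= y)%O -> entry (bracket f (E x y)) u v =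
  entry f u x * (v == y)%:R - (u == x)%:R * entry f y v.
Proof. by move=> xy; rewrite entry_bracket entryEM // entryME. Qed.

Lemma entry_bracketl x y f u v : (x <= y)%O -> entry (bracket (E x y) f) u v =
  (u == x)%:R * entry f y v - entry f u x * (v == y)%:R.
Proof. by move=> xy; rewrite entry_bracket entryEM // entryME. Qed.

Lemma entry_bracket_diagr f h u v : diagonal h ->
  entry (bracket f h) u v = entry f u v * (entry h v v - entry h u u).
Proof.
move=> dh; rewrite entry_bracket.
by rewrite (entryM_diagl _ _ _ dh) (entryM_diagr _ _ _ dh); ring.
Qed.

Lemma entry_bracket_diagl f h u v : diagonal h ->
  entry (bracket h f) u v = (entry h u u - entry h v v) * entry f u v.
Proof.
move=> dh; rewrite entry_bracket.
by rewrite (entryM_diagl _ _ _ dh) (entryM_diagr _ _ _ dh); ring.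
Qed.

Lemma bracketE_idemr x y : (x <= y)%O -> x != y ->
  bracket (E x y) (E y y) = E x y.
Proof.
move=> xy nxy; apply: eq_entry => u v; rewrite entry_bracketr // !entryE //.
by rewrite [y == x]eq_sym (negPf nxy) eqxx /=; ring.
Qed.

Lemma bracketE_ideml x y : (x <= y)%O -> x != y ->
  bracket (E x x) (E x y) = E x y.
Proof.
move=> xy nxy; apply: eq_entry => u v; rewrite entry_bracketl // !entryE //.
by rewrite (negPf nxy) eqxx /=; ring.
Qed.

Lemma bracketE_idem0 x y : x != y -> bracket (E x x) (E y y) = 0.
Proof.
move=> nxy; apply: eq_entry => u v; rewrite entry_bracketl // !entryE //.
by rewrite entry0 (negPf nxy) /=; ring.
Qed.

(** * Images of the idempotents [E x x] *)

Section LieTriple.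
Context (L : {linear incidence X R -> incidence X R})
  (L_lie_triple : lie_triple_derivation L).

Lemma entry_lie_triple f g h u v : entry (L (bracket (bracket f g) h)) u v =
  entry (bracket (bracket (L f) g) h) u v +
  entry (bracket (bracket f (L g)) h) u v +
  entry (bracket (bracket f g) (L h)) u v.
Proof. by rewrite !bracket_lie L_lie_triple 2!entryD. Qed.

(** As [E x x] and [E y y] commute, the triple identity with a free third argument makes [c]
    central, hence diagonal; its [(x, y)] entry is the sum of the two entries. *)
Lemma lie_triple_idem_antisym x y : x != y ->
  entry (L (E x x)) x y = - entry (L (E y y)) x y.
Proof.
move=> xy; set c := lie (L (E x x)) (E y y) + lie (E x x) (L (E y y)).
have cc : central c.
  move=> z; apply/subr0_eq; rewrite -[LHS]/(lie c z) lieDl.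
  have := L_lie_triple (E x x) (E y y) z; rewrite -[lie (E x x) _]bracket_lie.
  by rewrite bracketE_idem0 // !lie0l raddf0 addr0 => /esym.
have := central_diagonal cc xy; rewrite /c entryD -!bracket_lie.
rewrite entry_bracketr // entry_bracketl // !eqxx (negPf xy) [y == x]eq_sym.
by rewrite (negPf xy) /= => e; apply/eqP; rewrite -addr_eq0 -e; apply/eqP; ring.
Qed.

(** In the triple identity for [E x x], [E u u], [E v v] the left side is zero, and at [(u, v)] only
    minus this entry survives on the right. *)
Lemma lie_triple_idem_offdiag0 x u v : u != v -> u != x -> v != x ->
  entry (L (E x x)) u v = 0.
Proof.
move=> uv ux vx; have := entry_lie_triple (E x x) (E u u) (E v v) u v.
have xu : x != u by rewrite eq_sym.
rewrite (bracketE_idem0 xu) !bracket0l raddf0 !entry0.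
rewrite !entry_bracketr // !entry_bracketl // [v == u]eq_sym !eqxx.
rewrite (negPf uv) (negPf ux) (negPf vx) /= => e.
by apply/oppr_inj; rewrite oppr0 [RHS]e; ring.
Qed.

(** * Lie triple derivations mapping each [E x x] to a diagonal element *)

Section DiagonalOnIdempotents.
Context (R2 : torsion_free2 R) (Ld : forall x, diagonal (L (E x x))).

(** [E x y] is [[[E x y, E y y], E y y]], and each term of the identity is a bracket with a diagonal
    element, which vanishes on the diagonal. *)
Lemma unit_diag0 x y v : (x <= y)%O -> x != y -> entry (L (E x y)) v v = 0.
Proof.
move=> xy nxy; have := entry_lie_triple (E x y) (E y y) (E y y) v v.
rewrite !bracketE_idemr // => ->; rewrite !(entry_bracket_diagr _ _ _ (Ld y)).
by rewrite !entry_bracketr // eqxx; have [->|_] := eqVneq v y; rewrite /=; ring.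
Qed.

(** Since [[[E x x, E x y], E x y] = 0], the [(x, x)] entry of the identity says that twice this
    entry is zero. *)
Lemma unit_transpose0 x y : (x <= y)%O -> x != y -> entry (L (E x y)) y x = 0.
Proof.
move=> xy nxy; have nyx : y != x by rewrite eq_sym.
have bEE : bracket (E x y) (E x y) = 0 by rewrite bracket_lie /lie subrr.
have := entry_lie_triple (E x x) (E x y) (E x y) x x.
rewrite bracketE_ideml // bEE raddf0 entry0.
rewrite !(entry_bracketl _ _ _ xy) !(entry_bracketr _ _ _ xy).
rewrite !entry_bracketl // !eqxx (negPf nxy) (negPf nyx) /= (Ld x nyx) => e.
by apply: R2; rewrite [RHS]e; ring.
Qed.

Definition weight x y : R := entry (L (E x y)) x y.

Lemma entry_offdiag f x y : x != y ->
  entry (L f) x y = weight x y * entry f x y.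
Proof.
move=> nxy; have nyx : y != x by rewrite eq_sym.
have [xy|xy] := boolP (x <= y)%O; last by rewrite !entry_out // mulr0.
(* The factor multiplying [entry g x y] does not depend on [g]; the choice [g = E x y] below
   identifies it with [weight x y]. *)
have Lxy g : entry (L g) x y = entry g x y * (entry (L (E x y)) x y -
    (entry (L (E x x)) x x - entry (L (E x x)) y y) -
    (entry (L (E y y)) y y - entry (L (E y y)) x x)).
  have ge : bracket (bracket (E x x) g) (E y y) =
      entry g x y *: E x y + entry g y x *: E y x.
    apply: eq_entry => u v; rewrite entryD !entryZ entry_bracketr //.
    rewrite !entry_bracketl // entryE // (negPf nyx).
    have [yx|yx] := boolP (y <= x)%O; first by rewrite entryE //=; ring.
    by rewrite [entry g y x]entry_out //=; ring.
  have := entry_lie_triple (E x x) g (E y y) x y.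
  rewrite ge linearD !linearZZ entryD !entryZ.
  rewrite !(entry_bracket_diagr _ _ _ (Ld y)) !entry_bracketr //.
  rewrite !(entry_bracket_diagl _ _ _ (Ld x)) !entry_bracketl //.
  rewrite !eqxx (negPf nxy) (negPf nyx) /=.
  have -> : entry g y x * entry (L (E y x)) x y = 0.
    have [yx|yx] := boolP (y <= x)%O; last by rewrite entry_out // mul0r.
    by rewrite unit_transpose0 // mulr0.
  rewrite addr0 !mulrBr => ->; ring.
by rewrite Lxy /weight [in RHS]Lxy entryE // !eqxx /=; ring.
Qed.

Lemma unit_weight x y : (x <= y)%O -> x != y -> L (E x y) = weight x y *: E x y.
Proof.
move=> xy nxy; apply: eq_entry => u v; rewrite entryZ.
have [->|uv] := eqVneq u v.
  rewrite unit_diag0 // entryE //.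
  have [->|_] := eqVneq v x; last by rewrite /=; ring.
  by rewrite (negPf nxy) /=; ring.
rewrite entry_offdiag // entryE //.
have [->|_] := eqVneq u x; last by rewrite /=; ring.
by have [->//|_] := eqVneq v y; rewrite /=; ring.
Qed.

(** This is the [(x, y)] entry of the identity for [E x y], [f], [E y y]: the terms with
    [weight x y] cancel, and the right side is the contribution of [L (E y y)]. *)
Lemma diag_defect f x y : (x <= y)%O -> x != y ->
  entry (L f) y y - entry (L f) x x = (entry f x x - entry f y y) *
    (entry (L (E y y)) y y - entry (L (E y y)) x x).
Proof.
move=> xy nxy; have nyx : y != x by rewrite eq_sym.
have := entry_lie_triple (E x y) f (E y y) x y.
rewrite (entry_offdiag _ nxy) unit_weight // !bracketZl entryZ.
rewrite !(entry_bracket_diagr _ _ _ (Ld y)) !entry_bracketr //.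
rewrite !entry_bracketl // !eqxx (negPf nxy) (negPf nyx) /= => e.
apply/eqP; rewrite -subr_eq0; apply/eqP.
by move/eqP: e; rewrite eq_sym -subr_eq0 => /eqP <-; ring.
Qed.

Lemma diag_const f x y : (x <= y)%O -> x != y ->
  entry (L f) x x = entry (L f) y y.
Proof.
move=> xy nxy; have := diag_defect (E y y) xy nxy.
rewrite !entryE // eqxx (negPf nxy) /=.
(* Here [e] reads [t = - t]. *)
set t := _ - _ => e; have t0 : t = 0.
  by apply: R2; move/eqP: e; rewrite -subr_eq0 => /eqP <-; ring.
by have := diag_defect f xy nxy; rewrite -/t t0 mulr0 => /subr0_eq.
Qed.

(** [E x z] is [[[E x y, E y z], E z z]]; the error from [L (E z z)] vanishes by [diag_const]. *)
Lemma weightD x y z : (x <= y)%O -> (y <= z)%O -> x != y -> y != z -> x != z ->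
  weight x z = weight x y + weight y z.
Proof.
move=> xy yz nxy nyz nxz; have xz := le_trans xy yz.
have := entry_lie_triple (E x y) (E y z) (E z z) x z.
rewrite entry_offdiag // (unit_weight xy nxy) (unit_weight yz nyz).
rewrite bracketZr !bracketZl !entryZ.
rewrite (entry_bracket_diagr _ _ _ (Ld z)) (diag_const (E z z) xz nxz) subrr.
rewrite !entry_bracketr // !entryE // [z == x]eq_sym.
rewrite !eqxx (negPf nxy) (negPf nxz) [z == y]eq_sym (negPf nyz) /=.
by rewrite !mulr0 !mul0r !subr0 !mulr1 addr0.
Qed.

(** The degenerate case [z = x] of additivity, from [[[E x y, E y x], E x y] = 2 E x y]. *)
Lemma weight_inv x y : (x <= y)%O -> (y <= x)%O -> x != y ->
  weight x y + weight y x = 0.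
Proof.
move=> xy yx nxy; have nyx : y != x by rewrite eq_sym.
have := entry_lie_triple (E x y) (E y x) (E x y) x y.
rewrite entry_offdiag // !unit_weight // !bracketZr !bracketZl !entryZ.
rewrite !entry_bracketr // !entryE // !eqxx (negPf nxy) (negPf nyx) /= => e.
by apply: R2; move/eqP: e; rewrite eq_sym -subr_eq0 => /eqP <-; ring.
Qed.

(* weight x x = L(e_x)(x, x) need not vanish. *)
Definition cocycle x y : R := if x == y then 0 else weight x y.

Lemma cocycleD x y z : (x <= y)%O -> (y <= z)%O ->
  cocycle x z = cocycle x y + cocycle y z.
Proof.
move=> xy yz; rewrite /cocycle.
have [->|nxy] := eqVneq x y; first by rewrite add0r.
have [<-|nyz] := eqVneq y z; first by rewrite (negPf nxy) addr0.
have [zx|nxz] := eqVneq x z; last exact: weightD.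
by rewrite -zx weight_inv // zx.
Qed.

(** Off the diagonal the two terms cancel; on it [cocycle] is zero and [diag_const] applies. *)
Lemma lie_triple_sub_schur_central f : central (L f - schur cocycle f).
Proof.
apply: diagonal_central => x y => [nxy|xy nxy]; rewrite !entryB !entry_schur.
  by rewrite /cocycle (negPf nxy) entry_offdiag // subrr.
by rewrite /cocycle !eqxx !mul0r !subr0; exact: diag_const.
Qed.

End DiagonalOnIdempotents.

(** Formally the sum over [x] of [L (E x x) * E x x], given column by column because [X] may be
    infinite. *)
Definition idem_fun y x : R^o := entry (L (E x x)) y x.

Lemma idem_subproof : idem_fun \in @is_incidence d X R.
Proof. by apply/asboolP => x y xy; exact: entry_out. Qed.

Definition idem_incidence := Incidence idem_subproof.

Lemma diagonal_sub_inner x : diagonal (L (E x x) - lie idem_incidence (E x x)).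
Proof.
move=> u v uv; rewrite entryB -bracket_lie entry_bracketr //.
rewrite -[entry idem_incidence u x]/(entry (L (E x x)) u x).
rewrite -[entry idem_incidence x v]/(entry (L (E v v)) x v).
(* Column [x] cancels by construction, row [x] by antisymmetry, and all other off-diagonal entries
   of [L (E x x)] are zero. *)
have [vx|vx] := eqVneq v x; have [ux|ux] := eqVneq u x.
- by rewrite ux vx eqxx in uv.
- by rewrite vx /=; ring.
- rewrite ux lie_triple_idem_antisym //=; first by ring.
  by rewrite eq_sym.
- by rewrite lie_triple_idem_offdiag0 //=; ring.
Qed.

End LieTriple.

End Incidence.

Theorem mainTheorem2 (R : comPzRingType) (d : Order.disp_t)
    (X : locallyFinitePreorderType d)
    (R_2free : torsion_free2 R)
    (X_components : finite_set (components X))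
    (L : {linear incidence X R -> incidence X R})
    (L_lie_triple : lie_triple_derivation L) :
  exists D F : {linear incidence X R -> incidence X R},
    [/\ derivation D,
        forall f : incidence X R, central (F f)
      & forall f : incidence X R, L f = D f + F f].
Proof.
pose b := idem_incidence L.
pose M : {linear incidence X R -> incidence X R} := L \- lie b.
have M_lie_triple : lie_triple_derivation M.
  apply: lie_tripleB => //; apply: derivation_lie_triple.
  exact: lie_derivation.
have M_diag x : diagonal (M (E x x)) by exact: diagonal_sub_inner.
pose S : {linear incidence X R -> incidence X R} := schur (cocycle M).
pose D : {linear incidence X R -> incidence X R} := lie b \+ S.
pose F : {linear incidence X R -> incidence X R} := L \- D.
exists D, F; split=> [|f|f].
- apply: derivationD; first exact: lie_derivation.
  exact: schur_derivation (cocycleD M_lie_triple R_2free M_diag).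
(* Regrouping [L - (lie b + S)] as [(L - lie b) - S] reduces centrality to the case of diagonal
   images. *)
- suff -> : F f = M f - S f.
    exact: lie_triple_sub_schur_central M_lie_triple R_2free M_diag f.
  by change (L f - (lie b f + S f) = L f - lie b f - S f); rewrite opprD addrA.
- by rewrite /F /= addrC subrK.
Qed.
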